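(* For every integer $k\ge 0$, every integer $n\ge 1$ and every real $x$, $$W^{(k)}_{n}(x)=(-2)^{\frac{n(n-1)}{2}}\,\sin^{\frac{n(n+1)}{2}}(x)\,G(n+1)\,C^{(n)}_{k}(\cos x).$$
   Context: For smooth functions $f_1,\dots,f_n$ of a real variable $x$, $\mathrm{Wr}\{f_1,\dots,f_n\}$ denotes the Wronskian, i.e. the determinant of the $n\times n$ matrix whose $(i,j)$ entry is $f_j^{(i-1)}(x)$, $i,j=1,\dots,n$. Define $W^{(k)}_1(x):=\sin((k+1)x)$ and, for $n\ge 2$, $W^{(k)}_n(x):=\mathrm{Wr}\{\sin(x),\sin(2x),\dots,\sin((n-1)x),\sin((n+k)x)\}$. Here $G(n+1)=\prod_{j=0}^{n-1}j!$ (Barnes $G$-function at a positive integer), and $C^{(\lambda)}_k$ is the Gegenbauer polynomial, defined by $(1-2tz+z^2)^{-\lambda}=\sum_{k\ge0}C^{(\lambda)}_k(t)z^k$. *)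

(* Defs.v *)
From Stdlib Require Import Reals.
From Coquelicot Require Import Coquelicot.
From mathcomp Require Import all_boot all_algebra.
From mathcomp Require Import Rstruct.

Set Implicit Arguments.
Unset Strict Implicit.
Unset Printing Implicit Defensive.

Open Scope R_scope.

Definition Wr (n : nat) (fs : 'I_n -> R -> R) (x : R) : R :=
  (\det (\matrix_(i < n, j < n) Derive_n (fs j) (nat_of_ord i) x))%R.

Definition wfreq (n k : nat) (j : nat) : nat :=
  if (j < n.-1)%N then j.+1 else (n + k)%N.

Definition W (k n : nat) (x : R) : R :=
  if (n <= 1)%N then sin (INR (k + 1) * x)
  else Wr (fun j : 'I_n => fun y => sin (INR (wfreq n k j) * y)) x.

Definition barnesG_succ (n : nat) : R :=
  \big[Rmult/1]_(j < n) INR (j`!).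

(* Gegenbauer polynomial C_k^{(lambda)}(t) for integer lambda = m, defined as the
   k-th Taylor coefficient at z = 0 of the generating function
   (1 - 2 t z + z^2)^{-m}. *)
Definition gegenbauer (m k : nat) (t : R) : R :=
  Derive_n (fun z => / (1 - 2 * t * z + z ^ 2) ^ m) k 0 / INR (k`!).

(* Main.v *)
Require Import Defs.
From Stdlib Require Import Reals.
Open Scope R_scope.

(* With U_j the Chebyshev polynomials of the second kind, sin((j+1)x) = sin x U_j(cos x).
   The derivatives of sin x p(cos x) are combinations of p^(l)(cos x) with coefficients
   independent of p, forming a lower triangular matrix with diagonal sin x (- sin x)^i.
   So the Wronskian is the product of these diagonal entries and of the Wronskian of
   U_0, ..., U_(n-2), U_(n+k-1) at cos x, which is triangular too because deg U_j = j, with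
   last diagonal entry U_(n+k-1)^(n-1). Finally U_(m+k)^(m) = 2^m m! C^(m+1)_k, since by
   (j+1) U_(j+1) = X U_(j+1)' - U_j' both sides satisfy the recurrence
   (k+1) C^(m)_(k+1) = 2 m (t C^(m+1)_k - C^(m+1)_(k-1)) that comes from differentiating
   (1 - 2tz + z^2)^(-m). *)

From Stdlib Require Lra Lia.
From Coquelicot Require Coquelicot.
From mathcomp Require all_boot all_algebra Rstruct ring.

(* The imports are confined to this module because MathComp redefines the [nat]
   notations occurring in the theorem. *)
Module SineWronskian.

Import Lra Lia.
Import Coquelicot.Coquelicot.
Import all_boot all_algebra Rstruct.
Import GRing.Theory.

Set Implicit Arguments.
Unset Strict Implicit.
Unset Printing Implicit Defensive.

(** * Taylor coefficients of the generating function *)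

(* Coquelicot's tactics leave equations typed in [AbsRing.sort R_AbsRing], which
   [ring] and [field] do not recognize as the reals. *)
Ltac real_eq := match goal with |- @eq _ ?a ?b => change (@eq R a b) end.

Definition quad (t z : R) : R := 1 - 2 * t * z + z ^ 2.

(* The [k]-th derivative of [z => / quad t z ^ m]: since
   (q^-m)' = 2 m (t - z) q^-(m+1) and [t - z] is affine, the Leibniz rule leaves
   two terms. For [k' = 0] the junk value [k'.-1 = 0] is multiplied by 0. *)
Fixpoint quad_inv_deriv (t : R) (m k : nat) (z : R) : R :=
  match k with
  | 0%N => / quad t z ^ m
  | k'.+1 => 2 * INR m * ((t - z) * quad_inv_deriv t m.+1 k' z
               - INR k' * quad_inv_deriv t m.+1 k'.-1 z)
  end.

(** Differentiating [t - z] yields one more copy of the lower-order term, which raises its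
    coefficient from [k] to [k + 1]. The induction is strong because both orders in the recursion
    must be differentiated. *)
Lemma is_derive_quad_inv_deriv t k m z : quad t z <> 0 ->
  is_derive (quad_inv_deriv t m k) z (quad_inv_deriv t m k.+1 z).
Proof.
move=> q0; elim/ltn_ind: k m => -[|k] IH m.
  have dq : is_derive (quad t) z (2 * (z - t)).
    by rewrite /quad; auto_derive=> //; real_eq; ring.
  have qm0 j : quad t z ^ j <> 0 by exact: pow_nonzero.
  have -> : quad_inv_deriv t m 1 z = 2 * INR m * (t - z) * / quad t z ^ m.+1.
    by rewrite /=; ring.
  rewrite /quad_inv_deriv; move: (quad t) dq q0 qm0 => q dq q0 qm0.
  have Dq : Derive (fun x => q x) z = 2 * (z - t) by exact: is_derive_unique.
  auto_derive; first by split; [exists (2 * (z - t)) | split].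
  rewrite Dq; real_eq; case: m => [|m]; first by rewrite /=; field.
  rewrite (_ : m.+1.-1 = m) //.
  have qm := qm0 m; rewrite ![q z ^ _.+1]/=.
  by field.
have dk := IH k (ltnSn k) m.+1.
(* At order 1 the junk term has coefficient [INR 0] and is removed before differentiating. *)
case: k IH dk => [|k] IH dk.
  apply: (is_derive_ext (fun z => 2 * INR m * ((t - z) * quad_inv_deriv t m.+1 0 z))).
    by move=> y /=; real_eq; ring.
  have -> : quad_inv_deriv t m 2 z = 2 * INR m * ((t - z) * quad_inv_deriv t m.+1 1 z
               - 1 * quad_inv_deriv t m.+1 0 z) by [].
  move: (quad_inv_deriv t m.+1 0) (quad_inv_deriv t m.+1 1 z) dk => f l dk.
  have E : Derive (fun x => f x) z = l by exact: is_derive_unique.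
  auto_derive; first by exists l.
  by rewrite E; real_eq; ring.
have dk1 := IH k (leqW (ltnSn k)) m.+1.
change (quad_inv_deriv t m k.+2) with (fun z => 2 * INR m *
  ((t - z) * quad_inv_deriv t m.+1 k.+1 z - INR k.+1 * quad_inv_deriv t m.+1 k z)).
have -> : quad_inv_deriv t m k.+3 z = 2 * INR m * ((t - z) * quad_inv_deriv t m.+1 k.+2 z
               - INR k.+2 * quad_inv_deriv t m.+1 k.+1 z) by [].
move: (quad_inv_deriv t m.+1 k.+1) (quad_inv_deriv t m.+1 k.+2 z)
  (quad_inv_deriv t m.+1 k) dk dk1 => f l g df dg.
have Ef : Derive (fun x => f x) z = l by exact: is_derive_unique.
have Eg : Derive (fun x => g x) z = f z by exact: is_derive_unique.
rewrite (S_INR k.+1); move: (INR k.+1) => c.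
auto_derive; first by split; [exists l | split; [exists (f z) |]].
by rewrite Ef Eg; real_eq; ring.
Qed.

(** The derivative formula holds only off the roots of [quad t]; openness of that set allows it to
    be differentiated again. *)
Lemma quad_neq0_near t z : quad t z <> 0 -> locally z (fun y => quad t y <> 0).
Proof.
move=> q0; have c : continuous (quad t) z.
  apply: ex_derive_continuous; rewrite /quad; by auto_derive.
by apply: (c (fun y => y <> 0)); exact: open_neq.
Qed.

Lemma Derive_n_quad_inv t m k z : quad t z <> 0 ->
  Derive_n (fun z => / quad t z ^ m) k z = quad_inv_deriv t m k z.
Proof.
elim: k z => [//|k IH] z q0 /=.
rewrite (@Derive_ext_loc _ (quad_inv_deriv t m k)).
  exact: is_derive_unique (is_derive_quad_inv_deriv k m q0).
by apply: filter_imp (quad_neq0_near q0) => y; exact: IH.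
Qed.

Lemma gegenbauer0 m t : gegenbauer m 0 t = 1.
Proof. by rewrite /gegenbauer /= Rmult_0_r Rmult_0_l Rplus_0_r Rminus_0_r pow1; field. Qed.

(** This is the recursion of [quad_inv_deriv] at [z = 0] divided by [k!]; the Leibniz factor [k]
    turns [1/k!] into [1/(k-1)!]. *)
Lemma gegenbauerS m k t :
  INR k.+1 * gegenbauer m k.+1 t =
  2 * INR m * (t * gegenbauer m.+1 k t
    - (if k is k'.+1 then gegenbauer m.+1 k' t else 0)).
Proof.
have q0 : quad t 0 <> 0 by rewrite /quad; lra.
have fn0 j : INR j`! <> 0 by apply: not_0_INR => /eqP; apply/negP; rewrite -lt0n fact_gt0.
have Sn0 j : INR j.+1 <> 0 by exact: not_0_INR.
have c j i : gegenbauer j i t = quad_inv_deriv t j i 0 / INR i`!.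
  by rewrite -(Derive_n_quad_inv _ _ q0).
rewrite !c; case: k => [|k].
  by rewrite /=; field; split=> //; exact: pow_nonzero.
rewrite c (_ : quad_inv_deriv t m k.+2 0 =
  2 * INR m * ((t - 0) * quad_inv_deriv t m.+1 k.+1 0
               - INR k.+1 * quad_inv_deriv t m.+1 k 0)) //.
rewrite [k.+2`!]factS factS -!multE !mult_INR.
by field; do ![split].
Qed.

Import mathcomp.algebra_tactics.ring.
Local Open Scope ring_scope.

(** * Chebyshev polynomials of the second kind *)

Fixpoint chebU (n : nat) : {poly R} :=
  if n is n'.+1 then
    if n' is n''.+1 then 2%:R * 'X * chebU n' - chebU n'' else 2%:R * 'X
  else 1.

Lemma chebUSS n : chebU n.+2 = 2%:R * 'X * chebU n.+1 - chebU n.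
Proof. by []. Qed.

Lemma horner_natM (A : comNzRingType) n (p : {poly A}) t : (n%:R * p).[t] = n%:R * p.[t].
Proof. by rewrite !mulr_natl hornerMn. Qed.

Lemma sin_chebU n x : sin (INR n.+1 * x) = sin x * (chebU n).[cos x].
Proof.
elim/ltn_ind: n => -[|[|n]] IH.
- by rewrite hornerC Rmult_1_l mulr1.
- rewrite horner_natM hornerX S_INR /= Rmult_plus_distr_r Rmult_1_l sin_plus.
  by rewrite !(RmultE, RplusE, R1E); ring.
rewrite chebUSS hornerD hornerN -mulrA horner_natM hornerM hornerX mulrBr.
have -> : sin x * (2%:R * (cos x * (chebU n.+1).[cos x]))
  = 2%:R * cos x * (sin x * (chebU n.+1).[cos x]) by ring.
rewrite -!IH // !S_INR.
(* With [a = (n+2)x], the recurrence becomes sin(a + x) = 2 cos x sin a - sin(a - x). *)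
rewrite (_ : Rmult _ x = Rplus (Rmult (Rplus (Rplus (INR n) 1) 1) x) x); last first.
  by rewrite !(RmultE, RplusE, R1E); ring.
rewrite [in RHS](_ : Rmult (Rplus (INR n) 1) x =
  Rminus (Rmult (Rplus (Rplus (INR n) 1) 1) x) x); last first.
  by rewrite !(RmultE, RplusE, RminusE, R1E); ring.
rewrite sin_plus sin_minus !(RmultE, RplusE, RminusE); ring.
Qed.

Lemma chebU_degree n : (size (chebU n) <= n.+1)%N /\ (chebU n)`_n = 2%:R ^+ n.
Proof.
elim/ltn_ind: n => -[|[|n]] IH.
- by rewrite size_poly1 coef1.
- split; first by rewrite /= -polyC_natr mul_polyC (leq_trans (size_scale_leq _ _)) ?size_polyX.
  by rewrite /= -polyC_natr mul_polyC coefZ coefX mulr1.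
have [s1 c1] := IH n.+1 (ltnSn _); have [s0 _] := IH n (leqW (ltnSn _)).
rewrite chebUSS -mulrA -polyC_natr mul_polyC; split.
  apply: leq_trans (size_polyD _ _) _; rewrite geq_max size_polyN.
  rewrite (leq_trans s0) ?andbT; last by rewrite !ltnS leqW.
  apply: leq_trans (size_scale_leq _ _) _; rewrite mulrC.
  by apply: leq_trans (size_polyMleq _ _) _; rewrite size_polyX addn2.
by rewrite coefB coefZ coefXM /= c1 [(chebU n)`__]nth_default ?subr0 ?exprS ?(leqW s0).
Qed.

Lemma derivn_chebU_diag n : (chebU n)^`(n) = (2%:R ^+ n * n`!%:R)%:P.
Proof.
have [s c] := chebU_degree n; apply/polyP => i; rewrite coef_derivn coefC.
case: i => [|i]; first by rewrite addn0 c ffactnn mulr_natr.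
by rewrite nth_default ?mul0rn //; apply: leq_trans s _; rewrite addnS ltnS leq_addr.
Qed.

Lemma derivn_chebU_gt n j : (n < j)%N -> (chebU n)^`(j) = 0.
Proof. by move=> nj; apply: derivn_poly0; apply: leq_trans (proj1 (chebU_degree n)) nj. Qed.

Lemma derivnXM (A : comNzRingType) (p : {poly A}) j :
  ('X * p)^`(j.+1) = 'X * p^`(j.+1) + p^`(j) *+ j.+1.
Proof.
elim: j => [|j IH]; first by rewrite !derivn1 derivn0 derivM derivX mul1r addrC.
rewrite derivnS IH derivD derivM derivX mul1r derivMn -!derivnS.
rewrite [p^`(_) *+ j.+2]mulrS addrA; ring.
Qed.

(** The second identity closes the induction for the first: expanding U_(n+2) leaves the term (X^2 -
    1) U_(n+1)', which it evaluates. *)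
Lemma deriv_chebU n :
  ('X * (chebU n.+1)^`() - (chebU n)^`() = chebU n.+1 *+ n.+1) /\
  (('X ^+ 2 - 1) * (chebU n)^`() = chebU n.+1 *+ n.+1 - 'X * chebU n *+ n.+2).
Proof.
elim/ltn_ind: n => -[|n] IH.
  rewrite /= derivM derivX -polyC_natr !derivC; split; ring.
have [a1 b1] := IH n (ltnSn _).
have d2 : (chebU n.+2)^`() = 2%:R * chebU n.+1 + 2%:R * 'X * (chebU n.+1)^`() - (chebU n)^`().
  by rewrite chebUSS derivB !derivM derivX -polyC_natr derivC; ring.
have b2 : ('X ^+ 2 - 1) * (chebU n.+1)^`() = chebU n.+2 *+ n.+2 - 'X * chebU n.+1 *+ n.+3.
  case: n IH a1 b1 d2 => [|n] IH a1 b1 d2.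
    by rewrite /= derivM derivX -polyC_natr derivC; ring.
  have [_ b0] := IH n (leqW (ltnSn _)).
  rewrite chebUSS derivB !derivM derivX -polyC_natr derivC mul0r add0r mulr1 polyC_natr.
  have -> : ('X ^+ 2 - 1) * (2%:R * chebU n.+1 + 2%:R * 'X * (chebU n.+1)^`() - (chebU n)^`())
    = 2%:R * ('X^2 - 1) * chebU n.+1 + 2%:R * 'X * (('X ^+ 2 - 1) * (chebU n.+1)^`())
      - ('X ^+ 2 - 1) * (chebU n)^`() by ring.
  rewrite b1 b0 !chebUSS; ring.
split=> //.
have -> : 'X * (chebU n.+2)^`() - (chebU n.+1)^`() =
  2%:R * 'X * chebU n.+1 + 'X * ('X * (chebU n.+1)^`() - (chebU n)^`())
   + ('X ^+ 2 - 1) * (chebU n.+1)^`() by rewrite d2; ring.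
rewrite a1 b2 chebUSS; ring.
Qed.

(** The first identity of [deriv_chebU] is differentiated [m] times. The Leibniz rule adds [m]
    copies of U_(m+k+1)^(m), leaving [k + 1] of the [m + k + 1] on the other side. *)
Lemma derivn_chebU_rec m k :
  (chebU (m + k).+1)^`(m) *+ k.+1 =
  'X * (chebU (m + k).+1)^`(m.+1) - (chebU (m + k))^`(m.+1).
Proof.
have := congr1 (fun p => p^`(m)) (proj1 (deriv_chebU (m + k))).
rewrite derivnB derivnMn -[(chebU (m + k))^`()^`(m)]derivSn.
case: m => [|m].
  by rewrite derivn0 => <-; rewrite /derivn /= add0n.
rewrite derivnXM -!derivSn => E.
have -> : (chebU (m.+1 + k).+1)^`(m.+1) *+ k.+1 = (chebU (m.+1 + k).+1)^`(m.+1) *+ (m.+1 + k).+1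
   - (chebU (m.+1 + k).+1)^`(m.+1) *+ m.+1 by rewrite -addnS mulrnDr addrAC subrr add0r.
by rewrite -E addrAC addrK.
Qed.

Lemma INRE_gegenbauerS m k t :
  k.+1%:R * gegenbauer m k.+1 t =
  2%:R * m%:R * (t * gegenbauer m.+1 k t
    - (if k is k'.+1 then gegenbauer m.+1 k' t else 0)).
Proof.
have := gegenbauerS m k t.
by rewrite !(RmultE, RminusE, INRE) (IZRposE 2) INRE R0E.
Qed.

Lemma gegenbauer_chebU m k t :
  gegenbauer m.+1 k t * (2%:R ^+ m * m`!%:R) = ((chebU (m + k))^`(m)).[t].
Proof.
elim/ltn_ind: k m => -[|k] IH m.
  by rewrite gegenbauer0 mul1r addn0 derivn_chebU_diag hornerC.
have kn0 : k.+1%:R != 0 :> R by apply/eqP; rewrite -INRE; exact: not_0_INR.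
apply: (mulfI kn0); rewrite [RHS]mulr_natl -hornerMn addnS derivn_chebU_rec.
rewrite hornerD hornerN hornerM hornerX.
(* [d] is the coefficient of index [k - 1], with value 0 at index -1; this matches U_m^(m+1) = 0. *)
pose d : R := if k is k'.+1 then gegenbauer m.+2 k' t else 0.
have -> : (chebU (m + k))^`(m.+1).[t] = d * (2%:R ^+ m.+1 * m.+1`!%:R).
  rewrite {}/d; case: k IH {kn0} => [|k] IH; last by rewrite IH ?addnS // ltnW.
  by rewrite addn0 derivn_chebU_gt // horner0 mul0r.
rewrite -addSn -IH // [LHS]mulrA INRE_gegenbauerS -/d.
by rewrite factS natrM exprS; ring.
Qed.

(** * The Wronskian *)

Lemma is_derive_addR (f g : R -> R) (x a b : R) :
  is_derive f x a -> is_derive g x b -> is_derive (fun y => f y + g y) x (a + b).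
Proof. exact: is_derive_plus. Qed.

Lemma is_derive_mulR (f g : R -> R) (x a b : R) :
  is_derive f x a -> is_derive g x b ->
  is_derive (fun y => f y * g y) x (a * g x + f x * b).
Proof. by move=> df dg; apply: is_derive_mult => // *; exact: Rmult_comm. Qed.

Lemma is_derive_sumR n (f : 'I_n -> R -> R) (x : R) (d : 'I_n -> R) :
  (forall i, is_derive (f i) x (d i)) ->
  is_derive (fun y => \sum_i f i y) x (\sum_i d i).
Proof.
elim: n f d => [|n IH] f d df.
  rewrite big_ord0; apply: (is_derive_ext (fun=> 0 : R)); last exact: is_derive_const.
  by move=> y; rewrite big_ord0.
rewrite big_ord_recr /=.
apply: (is_derive_ext (fun y => \sum_(i < n) f (widen_ord (leqnSn n) i) y + f ord_max y)).
  by move=> y; rewrite big_ord_recr.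
by apply: is_derive_addR; [apply: IH | ].
Qed.

Lemma is_derive_horner (p : {poly R}) (x : R) : is_derive (horner p) x (p^`()).[x].
Proof.
elim/poly_ind: p => [|p c IH].
  rewrite derivC hornerC.
  by apply: (is_derive_ext (fun=> 0 : R)); [move=> y; rewrite hornerC | exact: is_derive_const].
apply: (is_derive_ext (fun y => p.[y] * y + c)).
  by move=> y; rewrite hornerD hornerMX hornerC.
rewrite derivD derivC addr0 derivM derivX mulr1 hornerD hornerMX.
rewrite -[X in is_derive _ _ X]addr0; apply: is_derive_addR; last exact: is_derive_const.
rewrite -[p.[x]]mulr1; apply: is_derive_mulR => //; exact: is_derive_id.
Qed.

Lemma is_derive_horner_cos (p : {poly R}) (x : R) :
  is_derive (fun y => p.[cos y]) x (- sin x * (p^`()).[cos x]).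
Proof. exact: is_derive_comp (is_derive_horner _ _) (is_derive_cos _). Qed.

(* A pair (P, Q) of polynomials encodes the function P(cos) + sin * Q(cos); these
   functions are closed under d/dx and under multiplication by - sin. *)
Definition trig_eval (a : {poly R} * {poly R}) (x : R) : R :=
  (a.1.[cos x] + sin x * a.2.[cos x])%R.

(** The factor [1 - 'X ^+ 2] is sin^2, arising when sin multiplies the derivative of Q(cos). *)
Definition trig_deriv (a : {poly R} * {poly R}) : {poly R} * {poly R} :=
  ('X * a.2 - (1 - 'X ^+ 2) * a.2^`(), - a.1^`()).

Definition trig_mulNsin (a : {poly R} * {poly R}) : {poly R} * {poly R} :=
  (- (1 - 'X ^+ 2) * a.2, - a.1).

Lemma sin2E (x : R) : sin x ^+ 2 = 1 - cos x ^+ 2.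
Proof. by have := sin2_cos2 x; rewrite /Rsqr !(RmultE, RplusE) -!expr2 => /(canRL (addrK _)). Qed.

Lemma is_derive_trig_eval a (x : R) :
  is_derive (trig_eval a) x (trig_eval (trig_deriv a) x).
Proof.
have -> : trig_eval (trig_deriv a) x = - sin x * (a.1^`()).[cos x] +
   (cos x * a.2.[cos x] + sin x * (- sin x * (a.2^`()).[cos x])).
  rewrite /trig_eval /trig_deriv /= !(hornerD, hornerN, hornerM, hornerX, hornerC, hornerXn).
  by rewrite -sin2E; ring.
apply: is_derive_addR; first exact: is_derive_horner_cos.
by apply: is_derive_mulR; [exact: is_derive_sin | exact: is_derive_horner_cos].
Qed.

Lemma trig_eval_mulNsin a (x : R) : trig_eval (trig_mulNsin a) x = - sin x * trig_eval a x.
Proof.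
rewrite /trig_eval /trig_mulNsin /= !(hornerD, hornerN, hornerM, hornerX, hornerC, hornerXn).
by rewrite -sin2E; ring.
Qed.

(* The coefficients, independent of [p], in
   (sin * p(cos))^(i) = sum_l sinW_coef i l * p^(l)(cos). *)
Fixpoint sinW_coef (i l : nat) : {poly R} * {poly R} :=
  match i with
  | 0%N => if l is 0%N then (0, 1) else (0, 0)
  | i'.+1 => trig_deriv (sinW_coef i' l)
             + (if l is l'.+1 then trig_mulNsin (sinW_coef i' l') else 0)
  end.

Lemma trig_evalD a b (x : R) : trig_eval (a + b) x = trig_eval a x + trig_eval b x.
Proof. by rewrite /trig_eval /= !hornerD; ring. Qed.

Lemma trig_eval0 (x : R) : trig_eval 0 x = 0.
Proof. by rewrite /trig_eval /= !horner0 mulr0 addr0. Qed.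

Lemma trig_deriv0 : trig_deriv 0 = 0.
Proof. by rewrite /trig_deriv /= deriv0 !mulr0 subr0 oppr0. Qed.

Lemma trig_mulNsin0 : trig_mulNsin 0 = 0.
Proof. by rewrite /trig_mulNsin /= mulr0 oppr0. Qed.

(** Each differentiation raises the order of the derivative of [p] by at most one, so the
    coefficient matrix is lower triangular. *)
Lemma sinW_coef_gt i l : (i < l)%N -> sinW_coef i l = 0.
Proof.
elim: i l => [|i IH] [|l] //= il.
by rewrite (IH _ (ltnW il)) (IH _ il) trig_deriv0 trig_mulNsin0 addr0.
Qed.

Lemma sinW_coef_diag i (x : R) : trig_eval (sinW_coef i i) x = sin x * (- sin x) ^+ i.
Proof.
elim: i => [|i IH].
  by rewrite /trig_eval /= !hornerC add0r.
rewrite [sinW_coef _ _]/= trig_evalD trig_eval_mulNsin IH (sinW_coef_gt (ltnSn i)).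
by rewrite exprS trig_deriv0 trig_eval0; ring.
Qed.

(** The bound [n] of the sum is the same for all [i], so that the Wronskian matrix factors into
    square matrices. *)
Lemma Derive_n_sin_horner_cos n i (p : {poly R}) (x : R) : (i < n)%N ->
  Derive_n (fun y => sin y * p.[cos y]) i x =
  \sum_(l < n) trig_eval (sinW_coef i l) x * (p^`(l)).[cos x].
Proof.
elim: i x => [|i IH] x lin.
  case: n lin => // n _; rewrite big_ord_recl big1 => [|j _].
    by rewrite /= /trig_eval !hornerC add0r mulr1 addr0.
  by rewrite /= /trig_eval !hornerC; ring.
rewrite [LHS]/= (Derive_ext _ _ _ (fun y => IH y (ltnW lin))).
apply: is_derive_unique.
have -> : \sum_(l < n) trig_eval (sinW_coef i.+1 l) x * (p^`(l)).[cos x] =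
  \sum_(l < n) (trig_eval (trig_deriv (sinW_coef i l)) x * (p^`(l)).[cos x]
    + trig_eval (sinW_coef i l) x * (- sin x * (p^`(l.+1)).[cos x])).
  rewrite big_split /=.
  under eq_bigr do rewrite trig_evalD mulrDl.
  rewrite big_split /=; congr (_ + _).
  (* The two sums agree after an index shift; the extra last term on the right has coefficient
     [sinW_coef i n], which is zero since [i < n]. *)
  case: n lin {IH} => // n lin; rewrite big_ord_recl [RHS]big_ord_recr /=.
  rewrite (@sinW_coef_gt i n lin) trig_eval0 !mul0r !addr0 ?add0r.
  by apply: eq_bigr => j _; rewrite trig_eval_mulNsin; ring.
apply: is_derive_sumR => l; apply: is_derive_mulR; first exact: is_derive_trig_eval.
by rewrite derivnS; exact: is_derive_horner_cos.
Qed.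

Lemma Wr_sin_horner_cos n (p : 'I_n -> {poly R}) (x : R) :
  Wr (fun j y => sin y * (p j).[cos y]) x =
  (\prod_(i < n) (sin x * (- sin x) ^+ i))
  * \det (\matrix_(l < n, j < n) ((p j)^`(l)).[cos x]).
Proof.
rewrite /Wr (_ : (\matrix_(i, j) _ : 'M[R]_n) =
  (\matrix_(i < n, l < n) trig_eval (sinW_coef i l) x) *m
  (\matrix_(l < n, j < n) ((p j)^`(l)).[cos x])); last first.
  apply/matrixP => i j; rewrite !mxE (@Derive_n_sin_horner_cos n) //.
  by apply: eq_bigr => l _; rewrite !mxE.
rewrite det_mulmx det_trig; last first.
  apply/is_trig_mxP => i j ij; by rewrite mxE sinW_coef_gt // trig_eval0.
by congr (_ * _); apply: eq_bigr => i _; rewrite mxE sinW_coef_diag.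
Qed.

(** The separate clause for [n = 1] is the 1 by 1 Wronskian, as [wfreq 1 k 0 = 1 + k]. *)
Lemma W_Wr k n (x : R) : (0 < n)%N ->
  W k n x = Wr (fun j : 'I_n => fun y => sin (INR (wfreq n k j) * y)) x.
Proof.
rewrite /W; case: n => [//|[_|//]] /=.
rewrite /Wr [\matrix_(_, _) _]mx11_scalar det_scalar1 !mxE /= /wfreq /=.
by rewrite addnC.
Qed.

Lemma W_det k n (x : R) :
  W k n.+1 x = (\prod_(i < n.+1) (sin x * (- sin x) ^+ i))
   * ((\prod_(j < n) (2%:R ^+ j * j`!%:R)) * ((chebU (n + k))^`(n)).[cos x]).
Proof.
rewrite W_Wr //.
(* [d j] is the Chebyshev degree, one less than the frequency. *)
pose d (j : nat) := if (j < n)%N then j else (n + k)%N.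
have wd (j : 'I_n.+1) : wfreq n.+1 k j = (d j).+1 by rewrite /wfreq /d; case: ifP.
rewrite (_ : Wr _ x = Wr (fun (j : 'I_n.+1) y => sin y * (chebU (d j)).[cos y]) x); last first.
  rewrite /Wr; congr (\det _); apply/matrixP => i j; rewrite !mxE.
  by apply: Derive_n_ext => y; rewrite wd sin_chebU.
rewrite Wr_sin_horner_cos; congr (_ * _).
(* U_j^(l) vanishes for [l > j], so it is the transpose that is lower triangular. *)
rewrite -det_tr det_trig; last first.
  apply/is_trig_mxP => i j ij; rewrite !mxE /d.
  have -> : (i < n)%N by rewrite (leq_trans ij) // -ltnS.
  by rewrite derivn_chebU_gt ?horner0.
rewrite big_ord_recr /= !mxE /d ltnn; congr (_ * _).
by apply: eq_bigr => j _; rewrite !mxE /= ltn_ord derivn_chebU_diag hornerC.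
Qed.

Lemma W_gegenbauer k n (x : R) :
  W k n.+1 x = (\prod_(i < n.+1) (sin x * (- 2%:R * sin x) ^+ i * i`!%:R))
   * gegenbauer n.+1 k (cos x).
Proof.
rewrite W_det -gegenbauer_chebU.
have -> : \prod_(i < n.+1) (sin x * (- 2%:R * sin x) ^+ i * i`!%:R) =
  \prod_(i < n.+1) (sin x * (- sin x) ^+ i) * \prod_(i < n.+1) (2%:R ^+ i * i`!%:R) :> R.
  rewrite -big_split /=; apply: eq_bigr => i _.
  rewrite (_ : - 2%:R * sin x = 2%:R * - sin x); last by ring.
  by rewrite exprMn; ring.
(* The factor [i = n] is the constant 2^n n! from [gegenbauer_chebU]. *)
rewrite [X in _ = _ * X * _]big_ord_recr /=; ring.
Qed.

(** * Triangular exponents and the Barnes product *)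

Lemma triangularS n :
  Nat.div (Nat.mul n.+1 (Nat.sub n.+1 1)) 2 = (Nat.div (Nat.mul n (Nat.sub n 1)) 2 + n)%N.
Proof.
(* Splitting off a multiple of 2 makes the truncated quotient grow by exactly [n], without a parity
   argument. *)
rewrite (_ : Nat.mul n.+1 _ = Nat.add (Nat.mul n 2) (Nat.mul n (Nat.sub n 1))).
  by rewrite Nat.div_add_l // addnC.
by case: n => [|n] //; nia.
Qed.

Lemma prod_barnesG n (s : R) :
  \prod_(i < n) (s * (- 2%:R * s) ^+ i * i`!%:R) =
  (- 2%:R) ^+ Nat.div (Nat.mul n (Nat.sub n 1)) 2 * s ^+ Nat.div (Nat.mul n (Nat.add n 1)) 2
  * barnesG_succ n.
Proof.
(* The exponent of [s] is the exponent of [-2] taken at [n + 1], so [triangularS] handles both. *)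
have -> : Nat.mul n (Nat.add n 1) = Nat.mul n.+1 (Nat.sub n.+1 1) by nia.
have -> : barnesG_succ n = \prod_(j < n) j`!%:R by apply: eq_bigr => j _; exact: INRE.
elim: n => [|n IH]; first by rewrite !big_ord0 !mulr1.
rewrite !triangularS in IH *; move: (Nat.div _ 2) IH => t IH.
by rewrite !big_ord_recr /= IH exprMn !exprD exprS; ring.
Qed.

Lemma W_closed_form (k n : nat) (x : R) : le 1 n ->
  W k n x =
  Rmult (Rmult (Rmult (pow (-2) (Nat.div (Nat.mul n (Nat.sub n 1)) 2))
                      (pow (sin x) (Nat.div (Nat.mul n (Nat.add n 1)) 2)))
    (barnesG_succ n)) (gegenbauer n k (cos x)).
Proof.
case: n => [/leP //|n] _.
by rewrite !(RmultE, RpowE) W_gegenbauer prod_barnesG.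
Qed.

End SineWronskian.

Theorem theorem1 (k n : nat) (x : R) (hn : (1 <= n)%nat) :
  W k n x =
  (-2) ^ (n * (n - 1) / 2) * (sin x) ^ (n * (n + 1) / 2)
    * barnesG_succ n * gegenbauer n k (cos x).
Proof. exact (SineWronskian.W_closed_form k x hn). Qed.
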